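(* Let $c_0$ and $m$ be non-zero constants and let $t_1,t_3,z$ be variables. Put $$x_1=-\frac{1}{m}z,\qquad x_2=\frac{1}{3m^3}(t_1+z^3),\qquad x_3=\frac{1}{6m^5}(2t_3-t_1z^2-z^5),$$ and define $$\begin{aligned} x_1^{*}&=c_0(x_1^3+3x_2),\\ x_2^{*}&=-c_0^3x_2\left(3x_1^6-30x_1^3x_2-60x_1x_3+5x_2^2\right),\\ x_3^{*}&=-\tfrac{c_0^5}{10}\big(15x_1^{12}x_2+30x_1^{10}x_3-105x_1^9x_2^2+300x_1^7x_2x_3-1140x_1^6x_2^3+150x_1^4x_2^2x_3\\ &\qquad-4545x_1^3x_2^4-6000x_1^2x_2x_3^2+4200x_1x_2^3x_3-357x_2^5-4000x_3^3\big). \end{aligned}$$ Then $$\begin{aligned} x_1^{*}&=\frac{c_0}{m^3}t_1,\\ x_2^{*}&=-\frac{c_0^3}{27m^9}(t_1+z^3)(5t_1^2+180t_3z+10t_1z^3+32z^6),\\ x_3^{*}&=-\frac{c_0^5}{810m^{15}}\big(-119t_1^5-12000t_3^3-4200t_1^3t_3z+6050t_1^4z^3-3150t_1^2t_3z^4+18745t_1^3z^6\\ &\qquad+3600t_1t_3z^7+21040t_1^2z^9+3360t_3z^{10}+10640t_1z^{12}+2176z^{15}\big). \end{aligned}$$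
   Context: All identities are polynomial identities in the independent variables $t_1,t_3,z$ (over $\mathbb{C}$). Background of the notation: $(t_1,t_2,t_3)$ are flat coordinates of an algebraic Frobenius prepotential $(H_3)'$ in which $z$ is the algebraic function with $t_2+t_1z+z^4=0$ (so $t_2=-t_1z-z^4$ is eliminated), and $(x_1,x_2,x_3)$ are flat coordinates of the polynomial prepotential of type $H_3$. *)

(* Defs.v *)
From mathcomp Require Export all_boot all_order all_algebra.
From mathcomp Require Export reals complex mpoly.

(* Main.v *)
(* The change of variables (t1, t3, z) -> (x1, x2, x3) has the polynomial inverse
     z = - m x1,  t1 = m^3 (x1^3 + 3 x2),  t3 = m^5 (3 x3 + (3/2) x1^2 x2).
   Substituting these into the right-hand sides turns each identity into one
   between polynomials in x1, x2, x3, up to a scalar factor m^3, m^9 or m^15. *)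

Require Import Defs.
From mathcomp Require Import all_boot all_order all_algebra.
From mathcomp Require Import reals complex mpoly ring.

Import GRing.Theory.
Local Open Scope ring_scope.

(* Identities in C[t1, t3, z], with C = R[i] the complex numbers. *)
Theorem theorem1 (R : realType) (c0 m : R[i]) (hc0 : c0 != 0) (hm : m != 0) :
  let t1 : {mpoly R[i][3]} := 'X_0 in
  let t3 : {mpoly R[i][3]} := 'X_1 in
  let z : {mpoly R[i][3]} := 'X_2 in
  let x1 : {mpoly R[i][3]} := - (1 / m) *: z in
  let x2 : {mpoly R[i][3]} := (1 / (3 * m ^+ 3)) *: (t1 + z ^+ 3) in
  let x3 : {mpoly R[i][3]} := (1 / (6 * m ^+ 5)) *: (2 * t3 - t1 * z ^+ 2 - z ^+ 5) in
  let x1' : {mpoly R[i][3]} := c0 *: (x1 ^+ 3 + 3 * x2) in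
  let x2' : {mpoly R[i][3]} := - c0 ^+ 3 *:
    (x2 * (3 * x1 ^+ 6 - 30 * x1 ^+ 3 * x2 - 60 * x1 * x3 + 5 * x2 ^+ 2)) in
  let x3' : {mpoly R[i][3]} := - (c0 ^+ 5 / 10) *:
    (15 * x1 ^+ 12 * x2 + 30 * x1 ^+ 10 * x3 - 105 * x1 ^+ 9 * x2 ^+ 2
     + 300 * x1 ^+ 7 * x2 * x3 - 1140 * x1 ^+ 6 * x2 ^+ 3
     + 150 * x1 ^+ 4 * x2 ^+ 2 * x3
     - 4545 * x1 ^+ 3 * x2 ^+ 4 - 6000 * x1 ^+ 2 * x2 * x3 ^+ 2
     + 4200 * x1 * x2 ^+ 3 * x3 - 357 * x2 ^+ 5 - 4000 * x3 ^+ 3) in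
  [/\ x1' = (c0 / m ^+ 3) *: t1,
      x2' = - (c0 ^+ 3 / (27 * m ^+ 9)) *:
        ((t1 + z ^+ 3) *
         (5 * t1 ^+ 2 + 180 * t3 * z + 10 * t1 * z ^+ 3 + 32 * z ^+ 6))
    & x3' = - (c0 ^+ 5 / (810 * m ^+ 15)) *:
        (- 119 * t1 ^+ 5 - 12000 * t3 ^+ 3 - 4200 * t1 ^+ 3 * t3 * z
         + 6050 * t1 ^+ 4 * z ^+ 3 - 3150 * t1 ^+ 2 * t3 * z ^+ 4
         + 18745 * t1 ^+ 3 * z ^+ 6
         + 3600 * t1 * t3 * z ^+ 7 + 21040 * t1 ^+ 2 * z ^+ 9
         + 3360 * t3 * z ^+ 10 + 10640 * t1 * z ^+ 12 + 2176 * z ^+ 15)].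
Proof.
move=> t1 t3 z x1 x2 x3 x1' x2' x3'.
have nz n : n.+1%:R != 0 :> R[i] by rewrite Num.Theory.pnatr_eq0.
pose M : {mpoly R[i][3]} := m%:MP.
(* Separates scalars from polynomials: the prefactors are compared in the field [R[i]], and the
   remaining identity, with [m] as the constant polynomial [M], is free of [*:] and open to
   [ring]. *)
have scale (a b : R[i]) n k (p q : {mpoly R[i][3]}) :
    a = b * (n%:R * m ^+ k) -> q = n%:R * M ^+ k * p -> a *: p = b *: q.
  move=> -> ->; rewrite -scalerA; congr (_ *: _).
  by rewrite -mul_mpolyC rmorphM rmorphXn rmorph_nat.
have unscale (a : R[i]) (p : {mpoly R[i][3]}) :
    a != 0 -> p = a%:MP * ((1 / a) *: p).
  by move=> a0; rewrite mul_mpolyC scalerA mulrC divfK // scale1r.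
have zE : z = - M * x1.
  by rewrite /x1 scaleNr mulrNN; apply: unscale.
have t1E : t1 = M ^+ 3 * (x1 ^+ 3 + 3 * x2).
  have: t1 + z ^+ 3 = (3 * m ^+ 3)%:MP * x2.
    by apply: unscale; rewrite mulf_neq0 ?expf_neq0.
  rewrite rmorphM rmorphXn rmorph_nat => /(canRL (addrK _)) ->.
  by rewrite zE; ring.
(* Halving x2 clears the denominator in the formula for t3. *)
pose y := 2^-1 *: x2.
have x2E : x2 = 2 * y.
  by rewrite -(rmorph_nat (@mpolyC 3 R[i])) mul_mpolyC scalerA divff ?scale1r.
have t3E : t3 = M ^+ 5 * (3 * x3 + 3 * x1 ^+ 2 * y).
  (* Polynomials form a domain, not a field, so 2 is cancelled rather than inverted. *)
  have n2 : 2 != 0 :> {mpoly R[i][3]}.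
    by rewrite -(rmorph_nat (@mpolyC 3 R[i])) mpolyC_eq0.
  apply: (mulfI n2).
  have: 2 * t3 - t1 * z ^+ 2 - z ^+ 5 = (6 * m ^+ 5)%:MP * x3.
    by apply: unscale; rewrite mulf_neq0 ?expf_neq0.
  rewrite rmorphM rmorphXn rmorph_nat.
  move=> /(canRL (subrK _)) /(canRL (subrK _)) ->.
  by rewrite t1E zE x2E; ring.
rewrite /x1' /x2' /x3'.
(* With the bodies forgotten, [x1], [x3], [y] and [M] are atoms for [ring]. *)
clearbody x1 x3 y M t1 t3 z.
rewrite t1E zE t3E x2E.
split.
(* Each pair is the ratio of left to right prefactor; in the last, 81 = 810 / 10. *)
- by apply: (scale _ _ 1 3); [field | ring].
- by apply: (scale _ _ 27 9); [field | ring].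
- by apply: (scale _ _ 81 15); [field | ring].
Qed.
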